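(* Let $n\ge 2$ and $k\ge 0$ be integers, let $G$ be a simple graph of order $n$, and let $\bar G$ be its complement. Then (1) $3\le \alpha_{k-reg}(G)+\alpha_{k-reg}(\bar G)\le 2n$; (2) $2\le \alpha_{k-reg}(G)\cdot\alpha_{k-reg}(\bar G)\le n^2$.
   Context: All graphs are finite, simple and undirected. For a graph $G$ and an integer $i\ge 0$, $D_i(G)$ denotes the set of vertices of degree $i$ in $G$. For an integer $k\ge 0$, a set $S\subseteq V(G)$ is $k$-independent if the induced subgraph $G[S]$ has maximum degree at most $k$. A regular $k$-independent set is a $k$-independent set $S$ with $S\subseteq D_i(G)$ for some $i$. The regular $k$-independence number $\alpha_{k-reg}(G)$ is the maximum cardinality of a regular $k$-independent set of $G$. *)

(* Defs.v *)
From mathcomp Require Import all_boot.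

Set Implicit Arguments.
Unset Strict Implicit.
Unset Printing Implicit Defensive.

Record sgraph (V : finType) := SGraph {
  adj :> rel V;
  adj_sym : symmetric adj;
  adj_irr : irreflexive adj
}.

Definition compl_adj (V : finType) (G : sgraph V) : rel V :=
  fun x y => (x != y) && ~~ adj G x y.

Lemma compl_adj_sym (V : finType) (G : sgraph V) : symmetric (compl_adj G).
Proof. by move=> x y; rewrite /compl_adj eq_sym adj_sym. Qed.

Lemma compl_adj_irr (V : finType) (G : sgraph V) : irreflexive (compl_adj G).
Proof. by move=> x; rewrite /compl_adj eqxx. Qed.

Definition compl (V : finType) (G : sgraph V) : sgraph V :=
  SGraph (@compl_adj_sym V G) (@compl_adj_irr V G).

Definition deg (V : finType) (G : sgraph V) (x : V) : nat :=
  #|[set y | adj G x y]|.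

Definition degset (V : finType) (G : sgraph V) (i : nat) : {set V} :=
  [set x | deg G x == i].

(* Degree of x in the subgraph induced by S (meaningful for x \in S). *)
Definition deg_in (V : finType) (G : sgraph V) (S : {set V}) (x : V) : nat :=
  #|[set y in S | adj G x y]|.

Definition k_independent (V : finType) (G : sgraph V) (k : nat) (S : {set V}) :
    bool :=
  \max_(x in S) deg_in G S x <= k.

(* Bounding i by #|V| is harmless: every degree is smaller than #|V|, and the
   empty set is contained in every degset. For V empty, i = 0 covers it. *)
Definition regular_k_independent (V : finType) (G : sgraph V) (k : nat)
    (S : {set V}) : bool :=
  k_independent G k S && [exists i : 'I_#|V|.+1, S \subset degset G i].

Lemma regular_k_independentP (V : finType) (G : sgraph V) (k : nat)
    (S : {set V}) :
  reflect (k_independent G k S /\ exists i : nat, S \subset degset G i)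
          (regular_k_independent G k S).
Proof.
apply: (iffP andP) => -[kS]; first by move=> /existsP[i Si]; split=> //; exists i.
move=> [i Si]; split=> //; apply/existsP.
have [/eqP S0|/set0Pn[x xS]] := boolP (S == set0).
  by exists ord0; rewrite S0 sub0set.
have := subsetP Si x xS; rewrite inE => /eqP dx.
have lti : i < #|V|.+1 by rewrite ltnS -dx max_card.
by exists (Ordinal lti).
Qed.

Definition alpha_reg (V : finType) (k : nat) (G : sgraph V) : nat :=
  \max_(S : {set V} | regular_k_independent G k S) #|S|.

(* Main.v *)
(** A simple graph with at least two vertices has two vertices [x], [y] of the
    same degree: otherwise the degrees would exhaust [0 .. n-1], and the vertex
    of degree [n-1] would be adjacent to the isolated one. Then [x] and [y]
    also have the same degree in the complement, and they are non-adjacent in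
    exactly one of the two graphs, where the pair is a regular independent
    set. In the other graph any single vertex is one. *)
Require Import Defs.
From mathcomp Require Import all_boot.

Section Degrees.
Variables (V : finType) (G : sgraph V).

Lemma neighbors_sub (x : V) : [set y | adj G x y] \subset [set~ x].
Proof.
apply/subsetP=> y; rewrite !inE; apply: contraTneq => ->.
by rewrite adj_irr.
Qed.

Lemma deg_lt_card (x : V) : deg G x < #|V|.
Proof.
have := subset_leq_card (neighbors_sub x); rewrite cardsC1 -/(deg G x).
(* The bound so far is the truncated [#|V|.-1], strict only when [V] is nonempty; [x] witnesses
   that. *)
by case: #|V| (fintype0 x) => // m _; rewrite ltnS.
Qed.

(** The neighbourhood of [x] lies in [[set~ x]] and has the same cardinality, so the two sets
    coincide. *)
Lemma adj_of_full_deg (x y : V) : deg G x = #|V|.-1 -> y != x -> adj G x y.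
Proof.
move=> dx nyx; have: [set z | adj G x z] == [set~ x].
  by rewrite eqEcard neighbors_sub cardsC1 -dx leqnn.
by move/eqP/setP/(_ y); rewrite !inE nyx.
Qed.

Lemma exists_same_deg :
  1 < #|V| -> exists x y : V, x != y /\ deg G x = deg G y.
Proof.
move=> V1; pose f x := Ordinal (deg_lt_card x).
have /injectivePn[x [y nxy /(congr1 val) dxy]] : ~~ injectiveb f.
  apply/negP=> /injectiveP f_inj.
  (* Domain and codomain both have [#|V|] elements, so an injective [f] attains every degree, in
     particular 0 and [#|V|.-1]. *)
  have [g fK gK] : bijective f by apply: inj_card_bij; rewrite ?card_ord.
  have lt0 : 0 < #|V| by apply: ltnW.
  have ltp : #|V|.-1 < #|V| by rewrite prednK.
  have dx : deg G (g (Ordinal lt0)) = 0 := congr1 val (gK (Ordinal lt0)).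
  have dy : deg G (g (Ordinal ltp)) = #|V|.-1 := congr1 val (gK (Ordinal ltp)).
  set x := g _ in dx; set y := g _ in dy.
  have nxy : x != y.
    (* If [x = y], then [#|V|.-1 = 0], contradicting [1 < #|V|]. *)
    by apply: contraTneq V1 => xy; rewrite -(prednK lt0) -dy -xy dx.
  have /eqP/setP/(_ y) : [set z | adj G x z] == set0.
    by rewrite -cards_eq0; apply/eqP.
  by rewrite !inE adj_sym adj_of_full_deg.
by exists x, y.
Qed.

Lemma deg_compl (x : V) : deg (compl G) x = #|V|.-1 - deg G x.
Proof.
rewrite -(cardsC1 x) /deg.
rewrite -(setIidPr (neighbors_sub x)) -cardsD.
apply: eq_card => y; rewrite !inE /= /compl_adj eq_sym.
by case: (y == x); case: (adj G x y).
Qed.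

End Degrees.

Section RegularIndependence.
Variables (V : finType) (k : nat) (G : sgraph V).

Lemma card_le_alpha_reg (S : {set V}) :
  regular_k_independent G k S -> #|S| <= alpha_reg k G.
Proof. exact: (leq_bigmax_cond (F := fun S : {set V} => #|S|)). Qed.

Lemma alpha_reg_le_card : alpha_reg k G <= #|V|.
Proof. by apply/bigmax_leqP=> S _; apply: max_card. Qed.

(** The pair induces no edge, so its induced degrees are 0 and any [k] will do. The case [x = y] is
    allowed and yields singletons. *)
Lemma regular_pair (x y : V) :
  deg G x = deg G y -> ~~ adj G x y -> regular_k_independent G k [set x; y].
Proof.
move=> dxy nxy; apply/regular_k_independentP; split; last first.
  by exists (deg G x); apply/subsetP=> z; rewrite !inE => /orP[]/eqP->; rewrite ?dxy.
apply/bigmax_leqP=> z zS; rewrite /deg_in (_ : [set _ in _ | _] = set0) ?cards0 //.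
apply/setP=> t; rewrite !inE; apply/negP=> /andP[tS].
move: zS; rewrite !inE => /orP[]/eqP->; case/orP: tS => /eqP->;
  by rewrite ?adj_irr ?(negPf nxy) // adj_sym (negPf nxy).
Qed.

Lemma alpha_reg_gt0 : 0 < #|V| -> 0 < alpha_reg k G.
Proof.
case/card_gt0P=> x _; have := regular_pair x x erefl.
by rewrite adj_irr setUid => /(_ isT)/card_le_alpha_reg; rewrite cards1.
Qed.

Lemma alpha_reg_gt1 (x y : V) :
  x != y -> deg G x = deg G y -> ~~ adj G x y -> 1 < alpha_reg k G.
Proof.
by move=> nxy dxy /(regular_pair _ _ dxy)/card_le_alpha_reg; rewrite cards2 nxy.
Qed.

End RegularIndependence.

Theorem theorem6p1 (n k : nat) (V : finType) (G : sgraph V)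
    (hn : 2 <= n) (hV : #|V| = n) :
  (3 <= alpha_reg k G + alpha_reg k (compl G) <= 2 * n) /\
  (2 <= alpha_reg k G * alpha_reg k (compl G) <= n ^ 2).
Proof.
rewrite -{n}hV in hn *.
have V0 : 0 < #|V| by apply: ltnW.
have a0 := alpha_reg_gt0 V k G V0; have b0 := alpha_reg_gt0 V k (compl G) V0.
have aV := alpha_reg_le_card V k G; have bV := alpha_reg_le_card V k (compl G).
have [x [y [nxy dxy]]] := exists_same_deg V G hn.
have ab : (1 < alpha_reg k G) || (1 < alpha_reg k (compl G)).
  have [Gxy|nGxy] := boolP (adj G x y); last by rewrite (alpha_reg_gt1 _ _ _ _ _ nxy).
  apply/orP; right; apply: (alpha_reg_gt1 _ _ _ _ _ nxy).
    by rewrite !deg_compl dxy.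
  by rewrite /= /compl_adj Gxy andbF.
rewrite mul2n -addnn leq_add // -mulnn leq_mul // !andbT.
(* One of the two numbers is at least 2 and the other at least 1, whence 3 = 2 + 1 and 2 = 2 * 1. *)
by case/orP: ab => H; split;
  [exact: (leq_add H b0) | exact: (leq_mul H b0)
  |exact: (leq_add a0 H) | exact: (leq_mul a0 H)].
Qed.
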